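(* Let $N$ be a positive integer with base-$\varphi$ representation $N=\sum_{k=R}^{L} d_k\varphi^k$, where $\varphi=\frac{1+\sqrt5}{2}$, $R\le 0\le L$ are integers, each $d_k\in\{0,1\}$, and $d_kd_{k+1}=0$ for all $k$. Suppose there is a positive index $j$ with $d_j=1$, and let $i$ be the smallest positive index with $d_i=1$. Then \[N = d_R(-1)^{-R}L_{-R}+\dots+d_{-1}(-1)^{1}L_1+d_0 \quad\text{if } i \text{ is even},\] \[N = d_R(-1)^{-R}L_{-R}+\dots+d_{-1}(-1)^{1}L_1+d_0-1 \quad\text{if } i \text{ is odd},\] i.e. $N=\sum_{k=R}^{-1}d_k(-1)^{-k}L_{-k}+d_0-\epsilon$ with $\epsilon=0$ for $i$ even and $\epsilon=1$ for $i$ odd, where $L_n$ denotes the $n$-th Lucas number.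
   Context: The Lucas numbers are defined by $L_0=2$, $L_1=1$, $L_n=L_{n-1}+L_{n-2}$. A base-$\varphi$ representation of $N$ is an expression $N=\sum_{k=R}^{L}d_k\varphi^k$ with digits $d_k\in\{0,1\}$, no two consecutive digits equal to $1$, and $R\le 0\le L$; every positive integer has a unique such representation (up to leading/trailing zeros). *)

(* Defs.v *)
From HB Require Import structures.
From mathcomp Require Import all_boot all_order all_algebra.
From mathcomp Require Import reals.
From mathcomp Require Import zify.

Set Implicit Arguments.
Unset Strict Implicit.
Unset Printing Implicit Defensive.

Import Order.TTheory GRing.Theory Num.Theory.
Local Open Scope ring_scope.

Fixpoint lucas (n : nat) : nat :=
  match n with
  | 0%N => 2
  | S n' => match n' with
            | 0%N => 1
            | S n'' => (lucas n' + lucas n'')%N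
            end
  end.

Definition golden (K : realType) : K := (1 + Num.sqrt 5) / 2.

(* The integers a, a + 1, ..., b in increasing order; empty when b < a. *)
Definition int_range (a b : int) : seq int :=
  [seq a + n%:Z | n <- iota 0 `|(Num.max 0 (b + 1 - a))%R|%N].

Lemma mem_int_range (a b k : int) : (k \in int_range a b) = (a <= k <= b).
Proof.
apply/mapP/idP => [[n]|kab].
  by rewrite mem_iota; lia.
by exists `|(k - a)%R|%N; [rewrite mem_iota|]; lia.
Qed.

Lemma int_range_uniq (a b : int) : uniq (int_range a b).
Proof. by rewrite map_inj_uniq ?iota_uniq // => m n; lia. Qed.

(* d carries the digits d_r, ..., d_l only: its values outside [r, l] are
   irrelevant. Leading and trailing zeros are allowed. *)
Record base_phi_rep (K : realType) (N : nat) (r l : int) (d : int -> nat) :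
    Prop := BasePhiRep {
  bpr_low : r <= 0;
  bpr_high : 0 <= l;
  bpr_digit : forall k : int, r <= k <= l -> d k = 0%N \/ d k = 1%N;
  bpr_nonconsecutive :
    forall k : int, r <= k -> k + 1 <= l -> (d k * d (k + 1)%R)%N = 0%N;
  bpr_value :
    N%:R = \sum_(k <- int_range r l) (d k)%:R * golden K ^ k
}.

Definition smallest_positive_one (l : int) (d : int -> nat) (i : nat) : Prop :=
  [/\ (0 < i)%N, i%:Z <= l, d i%:Z = 1%N
    & forall j : nat, (0 < j)%N -> j%:Z <= l -> d j%:Z = 1%N -> (i <= j)%N].

(* Main.v *)
Require Import Defs.
From HB Require Import structures.
From mathcomp Require Import all_boot all_order all_algebra.
From mathcomp Require Import reals.
From mathcomp Require Import zify ring lra.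

(** Conjugating [sqrt 5 |-> - sqrt 5] sends [phi] to [psi = 1 - phi], so
    [N] is also the sum of the [d_k psi^k]. Since
    [(-1)^m L_m = phi^(-m) + psi^(-m)], the claimed sum differs from [N] by
    [A - B], where [A] is the sum of the [d_k psi^k] over [k > 0] and [B] the
    sum of the [d_k phi^k] over [k < 0]. As no two digits 1 are adjacent,
    [0 <= B < 1], and [A] lies in ]0, 1[ if [i] is even and in ]-1, 0[ if [i]
    is odd; an integer in ]-1, 1[ is 0 and an integer in ]-2, 0[ is -1. *)

Set Implicit Arguments.
Unset Strict Implicit.
Unset Printing Implicit Defensive.

Import Order.TTheory GRing.Theory Num.Theory.
Local Open Scope ring_scope.

(** * Splitting and reindexing ranges of integers *)

Lemma perm_int_range_cat (a b c : int) : a <= c -> c <= b + 1 ->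
  perm_eq (int_range a b) (int_range a (c - 1) ++ int_range c b).
Proof.
move=> ac cb; apply: uniq_perm; first exact: int_range_uniq.
  rewrite cat_uniq !int_range_uniq /= andbT; apply/hasPn => k.
  by rewrite /= !mem_int_range; lia.
by move=> k; rewrite mem_cat !mem_int_range; lia.
Qed.

Lemma perm_int_range_shift (a b : int) (n : nat) : a + n%:Z = b + 1 ->
  perm_eq (int_range a b) [seq a + j%:Z | j <- index_iota 0 n].
Proof.
by move=> e; rewrite /int_range /index_iota subn0 (_ : `|_|%N = n) //; lia.
Qed.

(** The downward enumeration serves the negative exponents: read from -1 down, they give increasing
    powers of [phi^-1]. *)
Lemma perm_int_range_rev (a b : int) (n : nat) : a + n%:Z = b + 1 ->
  perm_eq (int_range a b) [seq b - j%:Z | j <- index_iota 0 n].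
Proof.
move=> e; apply: uniq_perm; first exact: int_range_uniq.
  by rewrite map_inj_uniq ?iota_uniq // => j k; lia.
move=> k; rewrite mem_int_range; apply/idP/mapP => [kab|[j]].
  by exists `|b - k|%N; [rewrite mem_index_iota|]; lia.
by rewrite mem_index_iota; lia.
Qed.

(** * Conjugation in the golden ring and Lucas numbers *)

Lemma sqr_eq_5sqr (m n : nat) : (m ^ 2 = 5 * n ^ 2)%N -> n = 0%N.
Proof.
case: n => // n e; exfalso.
have m0 : (0 < m)%N by case: m e => //; rewrite exp0n // => /eqP; lia.
(* The 5-adic valuation is even on the left and odd on the right. *)
have := congr1 (logn 5) e.
by rewrite lognM ?expn_gt0 // !lognX (logn_prime 5 (isT : prime 5)) /=; lia.
Qed.

(** The coefficients are chosen before the root [x], so the same pair serves [phi] and [1 - phi];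
    this replaces a conjugation automorphism. *)
Lemma exprz_golden_ring (K : fieldType) (k : int) : exists a b : int,
  forall x : K, x ^+ 2 = x + 1 -> x ^ k = a%:~R + b%:~R * x.
Proof.
have x0 (x : K) : x ^+ 2 = x + 1 -> x != 0.
  by move=> xx; apply/eqP => x0; move/eqP: xx;
     rewrite x0 expr0n /= add0r eq_sym oner_eq0.
have xV (x : K) : x ^+ 2 = x + 1 -> x^-1 = x - 1.
  move=> xx; apply: (mulfI (x0 _ xx)); rewrite mulfV ?x0 //.
  by rewrite mulrBr -expr2 xx; ring.
elim: k => [|n [a [b IH]]|n [a [b IH]]].
- by exists 1, 0 => x _; rewrite expr0z; ring.
- exists b, (a + b) => x xx.
  rewrite -addn1 PoszD expfzDr ?x0 // IH // expr1z rmorphD /=.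
  by ring: xx.
- exists (b - a), a => x xx.
  rewrite -addn1 PoszD opprD expfzDr ?x0 // IH // exprN1 xV // rmorphB /=.
  by ring: xx.
Qed.

Lemma sum_golden_ring (K : fieldType) (s : seq int) (d : int -> nat) :
  exists a b : int, forall x : K, x ^+ 2 = x + 1 ->
    \sum_(k <- s) (d k)%:R * x ^ k = a%:~R + b%:~R * x.
Proof.
elim: s => [|k s [a [b IH]]].
  by exists 0, 0 => x _; rewrite big_nil; ring.
have [a' [b' H]] := exprz_golden_ring K k.
exists ((d k)%:Z * a' + a), ((d k)%:Z * b' + b) => x xx.
by rewrite big_cons IH // H // !rmorphD !rmorphM /= -!pmulrn; ring.
Qed.

Section Golden.
Variable K : realType.
Let phi := golden K.

Lemma golden_sqr : phi ^+ 2 = phi + 1.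
Proof.
have s5 : Num.sqrt (5 : K) ^+ 2 = 5 by rewrite sqr_sqrtr.
by rewrite /phi /golden; field: s5.
Qed.

Lemma golden_gt1 : 1 < phi.
Proof.
have s5 : Num.sqrt (5 : K) ^+ 2 = 5 by rewrite sqr_sqrtr.
have s0 := sqrtr_ge0 (5 : K).
by rewrite /phi /golden; nra.
Qed.

Lemma golden_conj_sqr : (1 - phi) ^+ 2 = (1 - phi) + 1.
Proof. by ring: golden_sqr. Qed.

Lemma golden_irrational (a b : int) : a%:~R = b%:~R * phi -> b = 0.
Proof.
move=> e.
have e2 : (a ^+ 2)%:~R = (b * a + b ^+ 2)%:~R :> K.
  rewrite rmorphD /= !rmorphXn rmorphM /= e.
  by ring: golden_sqr.
have {e2} /(_ _ _ e2) e2 := @intr_inj K.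
(* Completing the square in [a^2 = b a + b^2]; 5 is the discriminant. *)
have : (`|(2 * a - b)%R| ^ 2 = 5 * `|b| ^ 2)%N.
  apply/eqP; rewrite -eqz_nat PoszM -!abszX !gez0_abs ?sqr_ge0 //.
  by apply/eqP; nia.
by move/sqr_eq_5sqr; lia.
Qed.

(** The sum is [a + b * phi] with integers [a], [b]. Being an integer forces [b = 0] by
    irrationality, so replacing [phi] by its conjugate changes nothing. *)
Lemma sum_golden_conj (n : nat) (s : seq int) (d : int -> nat) :
  n%:R = \sum_(k <- s) (d k)%:R * phi ^ k ->
  n%:R = \sum_(k <- s) (d k)%:R * (1 - phi) ^ k.
Proof.
have [a [b H]] := sum_golden_ring K s d.
rewrite !H ?golden_sqr ?golden_conj_sqr // => e.
have b0 : b = 0.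
  apply: (@golden_irrational (n%:Z - a)).
  by rewrite rmorphB /= -pmulrn e; ring.
by rewrite e b0; ring.
Qed.

Lemma lucas_golden (n : nat) : (lucas n)%:R = phi ^+ n + (1 - phi) ^+ n.
Proof.
elim/ltn_ind: n => -[|[|n]] IH; rewrite ?expr0 ?expr1 /=; try ring.
rewrite natrD -/(lucas n.+1) (IH n.+1) // (IH n) // !exprS.
by ring: golden_sqr.
Qed.

(** Since [phi * (1 - phi) = -1], inverting either root gives minus the other, so the sign turns
    Binet's formula into one for negative exponents. *)
Lemma lucas_golden_neg (k : int) : k <= 0 ->
  ((-1) ^ (- k) * (lucas `|- k|%N)%:Z)%:~R = phi ^ k + (1 - phi) ^ k.
Proof.
move=> k0; have -> : k = - (`|k|%N)%:Z by lia.
move: `|k|%N => n; rewrite opprK absz_nat -!exprnN -exprnP.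
have p0 : phi != 0 by have := golden_gt1; lra.
have iP : phi^-1 = - (1 - phi).
  by apply: (mulfI p0); rewrite mulfV //; ring: golden_sqr.
have iQ : (1 - phi)^-1 = - phi by rewrite -[1 - phi]opprK -iP invrN invrK.
rewrite -!exprVn iP iQ [(- (1 - phi)) ^+ n]exprNn [(- phi) ^+ n]exprNn.
rewrite rmorphM rmorphXn /= -pmulrn lucas_golden; ring.
Qed.

End Golden.

(** * Bounds for sums of non-adjacent digits *)

Definition zeckendorf (m : nat) (e : nat -> nat) : Prop :=
  (forall n, (n < m)%N -> e n = 0%N \/ e n = 1%N) /\
  (forall n, (n.+1 < m)%N -> (e n * e n.+1)%N = 0%N).

Lemma zeckendorfS m e :
  zeckendorf m.+1 e -> zeckendorf m (fun n => e n.+1).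
Proof. by move=> [h1 h2]; split=> n nm; [apply: h1|apply: h2]. Qed.

Lemma sum_digitsS (K : comNzRingType) m (e : nat -> nat) (x : K) :
  \sum_(0 <= n < m.+1) (e n)%:R * x ^+ n =
  (e 0%N)%:R + x * \sum_(0 <= n < m) (e n.+1)%:R * x ^+ n.
Proof.
rewrite big_nat_recl //= expr0 mulr1 mulr_sumr; congr (_ + _).
by apply: eq_bigr => n _; rewrite exprS mulrCA.
Qed.

(** Induction on [S = e 0 - q * S']. If [e 0 = 0], then [S'] is in ]-1, 1 + q[ and [q * (1 + q) = 1]
    puts [S] in ]-1, q[. If [e 0 = 1], no 1 follows, so [S'] is in ]-1, q[ and [S] lies above
    [1 - q^2 = q]. *)
Lemma sum_digits_alt_bounds (K : realFieldType) (q : K) m (e : nat -> nat) :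
  0 < q -> q ^+ 2 = 1 - q -> zeckendorf m e ->
  let S := \sum_(0 <= n < m) (e n)%:R * (- q) ^+ n in
  if (0 < m)%N && (e 0%N == 1%N) then q < S < 1 + q else -1 < S < q.
Proof.
move=> q0 qq; elim: m e => [|m IH] e he /=; first by rewrite big_nil; lra.
have := IH _ (zeckendorfS he); rewrite sum_digitsS /=.
set S := \sum_(0 <= n < m) _.
case: he => h1 h2; have [->|e1] := h1 0%N isT => /=.
  by case: ifP => _ /andP[]; rewrite -(ltr_pM2l q0) -(ltr_pM2l q0 S); lra.
rewrite e1 /=; case: ifP => [/andP[m0 /eqP e2]|_]; last first.
  by move=> /andP[]; rewrite -(ltr_pM2l q0) -(ltr_pM2l q0 S); lra.
by have := h2 0%N; rewrite e1 e2 ltnS => /(_ m0).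
Qed.

(** The same induction with [S = e 0 + q * S']; a leading 1 forces [S' < 1], a leading 0 leaves
    [S' < 1 + q]. *)
Lemma sum_digits_bounds (K : realFieldType) (q : K) m (e : nat -> nat) :
  0 < q -> q ^+ 2 = 1 - q -> zeckendorf m e ->
  let S := \sum_(0 <= n < m) (e n)%:R * q ^+ n in
  0 <= S < (if (0 < m)%N && (e 0%N == 1%N) then 1 + q else 1).
Proof.
move=> q0 qq; have q1 : q < 1 by nra.
elim: m e => [|m IH] e he /=; first by rewrite big_nil; lra.
have := IH _ (zeckendorfS he); rewrite sum_digitsS /=.
set S := \sum_(0 <= n < m) _.
case: he => h1 h2; have [->|e1] := h1 0%N isT => /=.
  by case: ifP => _ /andP[]; rewrite -(ler_pM2l q0) -(ltr_pM2l q0 S); lra.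
rewrite e1 /=; case: ifP => [/andP[m0 /eqP e2]|_]; last first.
  by move=> /andP[]; rewrite -(ler_pM2l q0) -(ltr_pM2l q0 S); lra.
by have := h2 0%N; rewrite e1 e2 ltnS => /(_ m0).
Qed.

(** * The positive and negative parts of the representation *)

Section Representation.
Variables (K : realType) (N : nat) (r l : int) (d : int -> nat).
Hypothesis hrep : base_phi_rep K N r l d.
Let phi := golden K.
Let q := phi - 1.

Let q_gt0 : 0 < q.
Proof. by rewrite subr_gt0; exact: golden_gt1. Qed.

Let q_sqr : q ^+ 2 = 1 - q.
Proof. by rewrite /q; ring: (golden_sqr K : phi ^+ 2 = phi + 1). Qed.

Lemma zeckendorf_incr (a : int) (m : nat) : r <= a -> a + m%:Z <= l + 1 ->
  zeckendorf m (fun n => d (a + n%:Z)).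
Proof.
case: hrep => _ _ h1 h2 _ ra am; split=> n nm; first by apply: h1; lia.
by rewrite (_ : a + n.+1%:Z = a + n%:Z + 1); [apply: h2|]; lia.
Qed.

Lemma zeckendorf_decr (b : int) (m : nat) : r + m%:Z <= b + 1 -> b <= l ->
  zeckendorf m (fun n => d (b - n%:Z)).
Proof.
case: hrep => _ _ h1 h2 _ ra am; split=> n nm; first by apply: h1; lia.
rewrite mulnC (_ : b - n%:Z = b - n.+1%:Z + 1); last lia.
by apply: h2; lia.
Qed.

Lemma negative_digits_bounds :
  0 <= \sum_(k <- int_range r (-1)) (d k)%:R * phi ^ k < 1.
Proof.
have r0 := bpr_low hrep; have l0 := bpr_high hrep.
have e : r + `|r|%N%:Z = -1 + 1 by lia.
rewrite (perm_big _ (perm_int_range_rev e)) /= big_map.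
have hz : zeckendorf `|r| (fun n => d (-1 - n%:Z)).
  by apply: zeckendorf_decr; lia.
have p0 : phi != 0 by have := golden_gt1 K; rewrite -/phi; lra.
have pV : phi^-1 = q.
  apply: (mulfI p0); rewrite mulfV // /q.
  by ring: (golden_sqr K : phi ^+ 2 = phi + 1).
(* One factor [q] comes out of the sum, and [q * (1 + q) = 1] gives the bound 1. *)
have qE n : phi ^ (-1 - n%:Z) = q * q ^+ n.
  by rewrite -opprD -[1 + n%:Z]/(n.+1%:Z) -exprnN -exprVn pV exprS.
under eq_bigr => n _ do rewrite qE mulrCA.
rewrite -mulr_sumr; have := sum_digits_bounds q_gt0 q_sqr hz.
rewrite /=; set T := \sum_(0 <= n < _) _ => /andP[T0 T1].
have {}T1 : T < 1 + q by move: T1; have := q_gt0; case: ifP => _; lra.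
have qT : q * T < q * (1 + q) by rewrite ltr_pM2l ?q_gt0.
have qq : q * (1 + q) = 1 by rewrite mulrDr mulr1 -expr2 q_sqr; ring.
apply/andP; split; first exact: mulr_ge0 (ltW q_gt0) T0.
by rewrite -[ltRHS]qq.
Qed.

Lemma positive_digits_conj (i : nat) : smallest_positive_one l d i ->
  exists2 S : K, 0 < S < 1 + q &
    \sum_(k <- int_range 1 l) (d k)%:R * (1 - phi) ^ k = (- q) ^+ i * S.
Proof.
move=> [i0 il di imin]; have r0 := bpr_low hrep.
have hz : zeckendorf `|(l + 1 - i%:Z)%R| (fun n => d (i%:Z + n%:Z)).
  by apply: zeckendorf_incr; lia.
exists (\sum_(0 <= n < `|(l + 1 - i%:Z)%R|) (d (i%:Z + n%:Z))%:R * (- q) ^+ n).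
  have := sum_digits_alt_bounds q_gt0 q_sqr hz.
  rewrite /= addr0 di eqxx andbT ifT; last lia.
  by set S := \sum_(0 <= n < _) _; have := q_gt0; lra.
have psi0 : - q != 0 by have := q_gt0; lra.
rewrite (_ : 1 - phi = - q); last by rewrite opprB.
have i1 : 1 <= i%:Z by lia.
have il' : i%:Z <= l + 1 by lia.
rewrite (perm_big _ (perm_int_range_cat i1 il')) big_cat /=.
(* By minimality of [i], the digits at 1, ..., [i - 1] vanish, so [(- q) ^+ i] factors out of the
   rest. *)
rewrite big_seq big1 ?add0r => [|k]; last first.
  rewrite mem_int_range => /andP[k1 ki].
  have kE : k = `|k|%N%:Z by lia.
  have rkl : r <= k <= l by lia.
  have [->|dk] := bpr_digit hrep rkl; rewrite ?mul0r //.
  by exfalso; rewrite kE in dk; have := imin _ _ _ dk; lia.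
have e : i%:Z + `|(l + 1 - i%:Z)%R|%N%:Z = l + 1 by lia.
rewrite (perm_big _ (perm_int_range_shift e)) /= big_map mulr_sumr; apply: eq_bigr => n _.
by rewrite expfzDr // mulrCA -!exprnP.
Qed.

(** With [N] written in powers of [1 - phi], the digit at 0 and the conjugate powers with negative
    exponents cancel. *)
Lemma golden_rep_difference :
  (N%:Z - (\sum_(k <- int_range r (-1))
             (d k)%:Z * (-1) ^ (- k) * (lucas `|(- k)%R|%N)%:Z + (d 0)%:Z))%:~R =
  \sum_(k <- int_range 1 l) (d k)%:R * (1 - phi) ^ k -
  \sum_(k <- int_range r (-1)) (d k)%:R * phi ^ k.
Proof.
have r0 := bpr_low hrep; have l0 := bpr_high hrep.
have NE := sum_golden_conj (bpr_value hrep).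
rewrite rmorphB rmorphD rmorph_sum /= -!pmulrn NE.
have l1 : 0 <= l + 1 by lia.
have l2 : 0 + 1 <= l + 1 by lia.
rewrite (perm_big _ (perm_int_range_cat r0 l1)) big_cat /=.
rewrite (perm_big _ (perm_int_range_cat (_ : 0 <= 0 + 1) l2)) // big_cat /=.
rewrite [\sum_(k <- int_range 0 _) _]big_seq1 /= expr0z mulr1 sub0r add0r.
set A := \sum_(k <- int_range 1 l) _.
rewrite (_ : \sum_(k <- int_range r (-1)) _%:~R =
  \sum_(k <- int_range r (-1)) (d k)%:R * phi ^ k +
  \sum_(k <- int_range r (-1)) (d k)%:R * (1 - phi) ^ k); first ring.
rewrite -big_split big_seq [RHS]big_seq /=; apply: eq_bigr => k.
rewrite mem_int_range => kr.
by rewrite -mulrDr -mulrA rmorphM /= lucas_golden_neg -?pmulrn //; lia.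
Qed.

End Representation.

(** * Conclusion by parity of the smallest positive index *)

Theorem theorem2 (K : realType) (N : nat) (r l : int) (d : int -> nat) (i : nat)
    (hN : (0 < N)%N)
    (hrep : base_phi_rep K N r l d)
    (hi : smallest_positive_one l d i) :
  (~~ odd i ->
     N%:Z = \sum_(k <- int_range r (-1))
              (d k)%:Z * (-1) ^ (- k) * (lucas `|(- k)%R|%N)%:Z + (d 0)%:Z) /\
  (odd i ->
     N%:Z = \sum_(k <- int_range r (-1))
              (d k)%:Z * (-1) ^ (- k) * (lucas `|(- k)%R|%N)%:Z + (d 0)%:Z - 1).
Proof.
have := golden_rep_difference hrep.
set M := \sum_(k <- _) _ + _; move=> hM.
have [S hS AE] := positive_digits_conj hrep hi.
have hB := negative_digits_bounds hrep.
move: hM hB; rewrite AE; set B := \sum_(k <- _) _; move=> hM hB.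
set q := golden K - 1 in hS hM AE.
have q0 : 0 < q by rewrite subr_gt0; exact: golden_gt1.
have qq : q * (1 + q) = 1 by rewrite /q; ring: (golden_sqr K).
have q1 : q < 1 by nra.
have [i0 _ _ _] := hi.
(* As [i > 0], one factor [q] is available to give [q * S < q * (1 + q) = 1]. *)
have hA : 0 < q ^+ i * S < 1.
  case: i i0 {hi hM AE} => // i _; rewrite exprS.
  have : 0 < q ^+ i <= 1.
    by rewrite exprn_gt0 //= exprn_ile1 // ltW.
  move: (q ^+ i) => x; have : 0 < q * S < 1 by nra.
  by nra.
(* Splitting [(- q) ^+ i] isolates the sign, and the real bounds transfer to the integer [N - M]. *)
have bounds (a b : int) : a%:~R < q ^+ i * S * (-1) ^+ i - B < b%:~R ->
    a < N%:Z - M < b.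
  by rewrite -[in X in X -> _]mulrAC -exprMn mulrN1 -hM !ltr_int.
split=> hodd; move: bounds; rewrite -signr_odd ?(negbTE hodd) ?hodd ?expr1 => bounds.
  have : -1 < N%:Z - M < 1 by apply: bounds; rewrite rmorphN /= rmorph1; lra.
  lia.
have : -2 < N%:Z - M < 0 by apply: bounds; rewrite rmorphN /=; lra.
lia.
Qed.
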